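(* Let $n\ge p\ge 1$, let $x_1,\ldots,x_n\in\mathbb{R}^p$ be fixed vectors such that $\Sigma_n=n^{-1}\sum_{i=1}^n x_ix_i^{\rm t}$ has full rank, and let $y_i=x_i^{\rm t}\beta+\varepsilon_i$ for $i=1,\ldots,n$, with $\beta\in\mathbb{R}^p$ and $\varepsilon_1,\ldots,\varepsilon_n$ i.i.d. $N(0,\sigma^2)$, $\sigma>0$. Let $x_0\in\mathbb{R}^p$, $\mu=x_0^{\rm t}\beta$, let $S$ be a subset of $\{1,\ldots,p\}$, and let $\hat\mu_S=x_{0,S}^{\rm t}\hat\beta_S$ be the submodel based estimator of $\mu$. Put $\omega_S=\Sigma_{10,S}\Sigma_{00,S}^{-1}x_{0,S}-x_{0,S^c}$, a vector of length $|S^c|=p-|S|$. Then: (i) $\hat\mu_S$ has bias ${\rm E}\,\hat\mu_S-\mu=\omega_S^{\rm t}\beta_{S^c}$. (ii) $x_0^{\rm t}\Sigma_n^{-1}x_0=x_{0,S}^{\rm t}\Sigma_{n,S}^{-1}x_{0,S}+\omega_S^{\rm t}Q_S\omega_S$. (iii) The mean squared error ${\rm mse}_S={\rm E}\,(\hat\mu_S-\mu)^2$ can be expressed as $$\begin{aligned}{\rm mse}_S&=(\sigma^2/n)\,x_{0,S}^{\rm t}\Sigma_{n,S}^{-1}x_{0,S}+(\omega_S^{\rm t}\beta_{S^c})^2\\&=(\sigma^2/n)\{x_{0,S}^{\rm t}\Sigma_{n,S}^{-1}x_{0,S}+n(\omega_S^{\rm t}\beta_{S^c})^2/\sigma^2\}\\&=(\sigma^2/n)\{x_0^{\rm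 t}\Sigma_n^{-1}x_0+n(\omega_S^{\rm t}\beta_{S^c})^2/\sigma^2-\omega_S^{\rm t}Q_S\omega_S\}.\end{aligned}$$
   Context: For $u\in\mathbb{R}^p$ and $S\subseteq\{1,\ldots,p\}$, $u_S$ denotes the subvector of entries $u_j$ with $j\in S$, and $S^c$ is the complement of $S$. The matrix $\Sigma_n$ is blocked according to indices inside $S$ (block index 0) and outside $S$ (block index 1): $\Sigma_{00,S}$ is the submatrix with rows and columns in $S$, $\Sigma_{01,S}$ has rows in $S$ and columns in $S^c$, $\Sigma_{10,S}=\Sigma_{01,S}^{\rm t}$, and $\Sigma_{11,S}$ has rows and columns in $S^c$. Write $\Sigma_{n,S}=\Sigma_{00,S}=n^{-1}\sum_{i=1}^n x_{i,S}x_{i,S}^{\rm t}$. The submodel least squares estimator is $\hat\beta_S=\Sigma_{n,S}^{-1}n^{-1}\sum_{i=1}^n x_{i,S}y_i$. The matrix $Q_S=(\Sigma_{11,S}-\Sigma_{10,S}\Sigma_{00,S}^{-1}\Sigma_{01,S})^{-1}$, of size $|S^c|\times|S^c|$, is the $S^c$-block of $\Sigma_n^{-1}$. Terms involving empty index sets are read as zero (so $\hat\mu_\emptyset=0$). All expectations are under the full (''wide'') model $y_i=x_i^{\rm t}\beta+\varepsilon_i$, i.e. the submodel need not be correct. *)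

(* Defs.v *)
From HB Require Import structures.
From mathcomp Require Import all_boot all_order all_algebra.
From mathcomp Require Import all_classical all_reals all_analysis.

Set Implicit Arguments.
Unset Strict Implicit.
Unset Printing Implicit Defensive.

Import Order.TTheory GRing.Theory Num.Theory.

Local Open Scope classical_set_scope.
Local Open Scope ring_scope.

(* u^t v, as a scalar; for p = 0 this is 0. *)
Definition dotv (R : realType) (p : nat) (u v : 'cV[R]_p) : R :=
  (u^T *m v) ord0 ord0.

(* Entries are listed in increasing order of their index in 'I_p. *)
Definition subv (R : realType) (p : nat) (S : {set 'I_p}) (u : 'cV[R]_p) :
    'cV[R]_#|S| :=
  rowsub enum_val u.

Definition submx_of (R : realType) (p : nat) (A : 'M[R]_p)
    (S U : {set 'I_p}) : 'M[R]_(#|S|, #|U|) :=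
  mxsub enum_val enum_val A.

Definition Sigma (R : realType) (n p : nat) (x : 'I_n -> 'cV[R]_p) : 'M[R]_p :=
  n%:R^-1 *: \sum_(i < n) x i *m (x i)^T.

Definition SigmaS (R : realType) (n p : nat) (x : 'I_n -> 'cV[R]_p)
    (S : {set 'I_p}) : 'M[R]_#|S| :=
  Sigma (fun i => subv S (x i)).

Definition Sigma00 (R : realType) (n p : nat) (x : 'I_n -> 'cV[R]_p)
    (S : {set 'I_p}) := submx_of (Sigma x) S S.
Definition Sigma01 (R : realType) (n p : nat) (x : 'I_n -> 'cV[R]_p)
    (S : {set 'I_p}) := submx_of (Sigma x) S (~: S)%SET.
Definition Sigma10 (R : realType) (n p : nat) (x : 'I_n -> 'cV[R]_p)
    (S : {set 'I_p}) := (Sigma01 x S)^T.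
Definition Sigma11 (R : realType) (n p : nat) (x : 'I_n -> 'cV[R]_p)
    (S : {set 'I_p}) := submx_of (Sigma x) (~: S)%SET (~: S)%SET.

Lemma SigmaSE (R : realType) (n p : nat) (x : 'I_n -> 'cV[R]_p)
  (S : {set 'I_p}) : SigmaS x S = Sigma00 x S.
Proof.
apply/matrixP => a b; rewrite !mxE !summxE; congr (_ * _).
by apply: eq_bigr => i _; rewrite !mxE; apply: eq_bigr => k _; rewrite !mxE.
Qed.

(* invmx A is A itself when A is singular; all inverses below are genuine when
   Sigma x is invertible, since Sigma x is then positive definite. *)
Definition Q (R : realType) (n p : nat) (x : 'I_n -> 'cV[R]_p)
    (S : {set 'I_p}) : 'M[R]_#|(~: S)%SET| :=
  invmx (Sigma11 x S - Sigma10 x S *m invmx (Sigma00 x S) *m Sigma01 x S).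

Definition omega (R : realType) (n p : nat) (x : 'I_n -> 'cV[R]_p)
    (x0 : 'cV[R]_p) (S : {set 'I_p}) : 'cV[R]_#|(~: S)%SET| :=
  Sigma10 x S *m invmx (Sigma00 x S) *m subv S x0 - subv (~: S)%SET x0.

Definition betahat (R : realType) (n p : nat) (x : 'I_n -> 'cV[R]_p)
    (y : 'I_n -> R) (S : {set 'I_p}) : 'cV[R]_#|S| :=
  invmx (SigmaS x S) *m (n%:R^-1 *: \sum_(i < n) y i *: subv S (x i)).

Definition muhat (R : realType) (n p : nat) (x : 'I_n -> 'cV[R]_p)
    (y : 'I_n -> R) (x0 : 'cV[R]_p) (S : {set 'I_p}) : R :=
  dotv (subv S x0) (betahat x y S).

Definition mutually_independent (d : measure_display) (T : measurableType d)
    (R : realType) (P : probability T R) (I : finType) (X : I -> T -> R) : Prop :=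
  forall (J : {set I}) (A : I -> set R), (forall i, measurable (A i)) ->
    P (\bigcap_(i in [set` J]) X i @^-1` A i) =
    (\prod_(i in J) P (X i @^-1` A i))%E.

Definition iid_normal (d : measure_display) (T : measurableType d)
    (R : realType) (P : probability T R) (I : finType) (m s : R)
    (X : I -> {RV P >-> R}) : Prop :=
  mutually_independent P (fun i => X i : T -> R) /\
  forall (i : I) (A : set R), measurable A ->
    distribution P (X i) A = normal_prob m s A.

(* Main.v *)
(* The estimator is linear in the data: muhat_S = sum_i c_i y_i with
   c_i = n^-1 g^t x_(i,S) and g = Sigma_S^-1 x_(0,S).  Evaluating it on the
   noiseless data x_i^t beta gives mu + omega^t beta_(S^c), and
   sum_i c_i^2 = n^-1 x_(0,S)^t Sigma_S^-1 x_(0,S).  Since the errors have mean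
   zero, variance sigma^2 and are uncorrelated, this yields the bias and the
   mean squared error.  Part (ii) follows from solving Sigma z = x_0 blockwise:
   the S^c-block of z is -Q omega. *)

Require Import Defs.
From HB Require Import structures.
From mathcomp Require Import all_boot all_order all_algebra.
From mathcomp Require Import all_classical all_reals all_analysis.
From mathcomp Require Import measurable_realfun ring lra.

Set Implicit Arguments.
Unset Strict Implicit.
Unset Printing Implicit Defensive.

Import Order.TTheory GRing.Theory Num.Theory.
Import numFieldNormedType.Exports.

Local Open Scope classical_set_scope.
Local Open Scope ring_scope.

(** * Partitioned vectors and matrices *)

Section DotProduct.
Variables (R : realType) (p : nat).
Implicit Types u v w : 'cV[R]_p.

Lemma dotvC u v : dotv u v = dotv v u.
Proof. by rewrite /dotv -[in LHS](trmxK v) -trmx_mul mxE. Qed.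

Lemma dotvDl u v w : dotv (u + v) w = dotv u w + dotv v w.
Proof. by rewrite /dotv linearD mulmxDl mxE. Qed.

Lemma dotvNl u v : dotv (- u) v = - dotv u v.
Proof. by rewrite /dotv linearN mulNmx mxE. Qed.

Lemma dotvBl u v w : dotv (u - v) w = dotv u w - dotv v w.
Proof. by rewrite dotvDl dotvNl. Qed.

Lemma dotvBr u v w : dotv u (v - w) = dotv u v - dotv u w.
Proof. by rewrite dotvC dotvBl !(dotvC u). Qed.

Lemma dotvNr u v : dotv u (- v) = - dotv u v.
Proof. by rewrite dotvC dotvNl dotvC. Qed.

Lemma dotv_mulmx m (B : 'M[R]_(p, m)) u (v : 'cV[R]_m) :
  dotv u (B *m v) = dotv (B^T *m u) v.
Proof. by rewrite /dotv trmx_mul trmxK mulmxA. Qed.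

Lemma dotvZr (a : R) u v : dotv u (a *: v) = a * dotv u v.
Proof. by rewrite /dotv -scalemxAr mxE. Qed.

Lemma dotv_sumr (I : finType) (f : I -> 'cV[R]_p) v :
  dotv v (\sum_i f i) = \sum_i dotv v (f i).
Proof. by rewrite /dotv mulmx_sumr summxE. Qed.

End DotProduct.

Section Selection.
Variables (R : realType) (p : nat).
Implicit Types (S U : {set 'I_p}) (u v : 'cV[R]_p) (A : 'M[R]_p).

(** The 0-1 matrix that extracts the coordinates in [S]. It turns subvectors and submatrices into
    matrix products, so that block identities reduce to associativity and the partition of the
    identity below. *)
Definition selmx S : 'M[R]_(#|S|, p) := rowsub enum_val 1%:M.

Lemma subvE S u : subv S u = selmx S *m u.
Proof. by rewrite mul_rowsub_mx mul1mx. Qed.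

Lemma dotv_subv S (g : 'cV[R]_#|S|) u :
  dotv g (subv S u) = dotv ((selmx S)^T *m g) u.
Proof. by rewrite subvE dotv_mulmx. Qed.

Lemma submx_ofE A S U : submx_of A S U = selmx S *m A *m (selmx U)^T.
Proof.
rewrite mul_rowsub_mx mul1mx; apply/matrixP => i j; rewrite !mxE.
rewrite (bigD1 (enum_val j))//= !mxE eqxx mulr1 big1 ?addr0// => k kj.
by rewrite !mxE eq_sym (negbTE kj) mulr0.
Qed.

(** Each product is the diagonal matrix of the indicator of its index set, and the indicators of [S]
    and of its complement add up to one. *)
Lemma selmx_partition S :
  (selmx S)^T *m selmx S + (selmx (~: S)%SET)^T *m selmx (~: S)%SET = 1%:M.
Proof.
have diagE U : (selmx U)^T *m selmx U = diag_mx (\row_k (k \in U)%:R).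
  apply/matrixP => i j; rewrite !mxE.
  under eq_bigr do rewrite !mxE -natrM mulnb.
  have [iU|iU] := boolP (i \in U).
    rewrite (bigD1 (enum_rank_in iU i))//= enum_rankK_in// eqxx big1 ?addr0// => k.
    apply: contraNeq; rewrite pnatr_eq0 eqb0 negbK => /andP[/eqP ki _].
    by apply/eqP/enum_val_inj; rewrite enum_rankK_in.
  rewrite big1 ?mul0rn// => k _; apply/eqP; rewrite pnatr_eq0 eqb0.
  apply: contra iU => /andP[/eqP <- _]; exact: enum_valP.
rewrite !diagE -raddfD/= -diag_const_mx; congr diag_mx; apply/rowP => k.
by rewrite !mxE inE; case: (k \in S); rewrite ?addr0 ?add0r.
Qed.

Lemma selmx_orthonormal S : selmx S *m (selmx S)^T = 1%:M.
Proof.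
rewrite mul_rowsub_mx mul1mx; apply/matrixP => i j; rewrite !mxE.
by rewrite (inj_eq enum_val_inj) eq_sym.
Qed.

Lemma selmx_orthogonal S : selmx S *m (selmx (~: S)%SET)^T = 0.
Proof.
rewrite mul_rowsub_mx mul1mx; apply/matrixP => i j; rewrite !mxE.
case: eqP => // ji; have := enum_valP j; have := enum_valP i.
by rewrite -ji inE => ->.
Qed.

Lemma dotv_split S u v :
  dotv u v =
  dotv (subv S u) (subv S v) + dotv (subv (~: S)%SET u) (subv (~: S)%SET v).
Proof.
rewrite /dotv !subvE !trmx_mul -!mulmxA -[v in LHS]mul1mx -(selmx_partition S).
by rewrite mulmxDl mulmxDr mxE !mulmxA.
Qed.

End Selection.

(** * Schur complements and block inversion *)

Section Blocks.
Variables (R : realType) (p : nat) (S : {set 'I_p}) (A : 'M[R]_p).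
Local Notation A00 := (submx_of A S S).
Local Notation A01 := (submx_of A S (~: S)%SET).
Local Notation A10 := (submx_of A (~: S)%SET S).
Local Notation A11 := (submx_of A (~: S)%SET (~: S)%SET).

Lemma trmx_submx_of (U V : {set 'I_p}) :
  A^T = A -> (submx_of A U V)^T = submx_of A V U.
Proof. by move=> As; apply/matrixP => i j; rewrite !mxE -{1}As mxE. Qed.

Lemma subv_mul U (u : 'cV[R]_p) :
  subv U (A *m u) = submx_of A U S *m subv S u
                    + submx_of A U (~: S)%SET *m subv (~: S)%SET u.
Proof.
rewrite !subvE !submx_ofE -!mulmxA -!mulmxDr; congr (_ *m (_ *m _)).
by rewrite -{1}[u]mul1mx -(selmx_partition R S) mulmxDl !mulmxA.
Qed.

Lemma schur_unitmx : A \in unitmx -> A00 \in unitmx ->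
  A11 - A10 *m invmx A00 *m A01 \in unitmx.
Proof.
move=> Au A00u; rewrite -row_free_unit -kermx_eq0.
set M := _ - _.
have : kermx M *m M = 0 by exact: mulmx_ker.
move: (kermx M) => K KM.
(* If [K M = 0] then [(- K A10 A00^-1, K) A = (0, K M) = 0]. *)
pose W := - (K *m A10 *m invmx A00) *m selmx R S + K *m selmx R (~: S)%SET.
have WA : W *m A = 0.
  rewrite -[A]mulmx1 -(selmx_partition R S) mulmxDr mulmxA.
  have W0 : W *m (A *m (selmx R S)^T) = 0.
    rewrite /W mulmxDl -!mulmxA !(mulmxA (selmx _ _)) -!submx_ofE.
    by rewrite !mulNmx -!mulmxA mulVmx// mulmx1 addNr.
  have W1 : W *m (A *m (selmx R (~: S)%SET)^T) = 0.
    rewrite /W mulmxDl -!mulmxA !(mulmxA (selmx _ _)) -!submx_ofE.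
    rewrite -[RHS]KM /M mulmxBr addrC; congr (_ + _).
    by rewrite !mulNmx !mulmxA.
  by rewrite mulmxDr !mulmxA -!(mulmxA W A) W0 W1 !mul0mx addr0.
have W0 : W = 0 by rewrite -(mulmxK Au W) WA mul0mx.
(* Reading off the columns of [W] in the complement of [S] leaves exactly [K], since the two
   selection matrices are orthonormal and mutually orthogonal. *)
apply/eqP; have : W *m (selmx R (~: S)%SET)^T = 0 by rewrite W0 mul0mx.
by rewrite /W mulmxDl -!mulmxA selmx_orthogonal selmx_orthonormal mulmx0 mulmx1 add0r.
Qed.

Lemma quad_inv_block (x0 : 'cV[R]_p) :
  A^T = A -> A \in unitmx -> A00 \in unitmx ->
  let w := A01^T *m invmx A00 *m subv S x0 - subv (~: S)%SET x0 in
  dotv x0 (invmx A *m x0) =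
  dotv (subv S x0) (invmx A00 *m subv S x0) +
  dotv w (invmx (A11 - A01^T *m invmx A00 *m A01) *m w).
Proof.
move=> As Au A00u w; have M_unit := schur_unitmx Au A00u.
(* By symmetry of [A], the transpose of the upper right block is the lower left block. *)
rewrite !trmx_submx_of// in w *.
set M := A11 - _ in M_unit *.
set z := invmx A *m x0.
have Az : A *m z = x0 by rewrite mulKVmx.
have E0 : subv S x0 = A00 *m subv S z + A01 *m subv (~: S)%SET z.
  by rewrite -subv_mul Az.
have E1 : subv (~: S)%SET x0 = A10 *m subv S z + A11 *m subv (~: S)%SET z.
  by rewrite -subv_mul Az.
have z0E : subv S z = invmx A00 *m (subv S x0 - A01 *m subv (~: S)%SET z).
  by rewrite E0 addrK mulKmx.
(* Eliminating the [S]-block of [z] from the second block equation leaves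
   [M *m subv (~: S) z = - w]. *)
have z1E : subv (~: S)%SET z = - (invmx M *m w).
  rewrite -mulmxN; apply: (can_inj (mulKmx M_unit)); rewrite mulKVmx//.
  rewrite /w E0 E1 mulmxDr mulmxA mulmxKV// /M mulmxBl -!mulmxA.
  by rewrite (addrC (A10 *m subv S z)) addrKA opprB.
(* After substituting for the [S]-block of [z], all terms linear in the other block combine to minus
   the product of [w] with that block, which is the quadratic form in [w]. *)
rewrite (dotv_split S) z0E mulmxBr dotvBr -addrA; congr (_ + _).
rewrite -[invmx M *m w]opprK -z1E dotvNr [in RHS]/w dotvBl opprB addrC.
by congr (_ - _); rewrite mulmxA dotv_mulmx trmx_mul trmx_inv !trmx_submx_of.
Qed.

End Blocks.

(** * Second moment of the normal law *)

(** Squeezed between 0 and [1 / x], because [x ^+ 2 <= 1 + x ^+ 2 <= expR (x ^+ 2)]. *)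
Lemma cvg_mul_gauss_fun (R : realType) : x * gauss_fun x @[x --> +oo%R] --> (0 : R).
Proof.
apply: (@squeeze_cvgr _ _ _ _ (cst 0) (fun x => x^-1)); last 2 first.
- exact: cvg_cst.
- apply/gtr0_cvgV0; first by near=> x.
  exact: cvg_id.
near=> x => /=; apply/andP; split; first by rewrite mulr_ge0 ?gauss_fun_ge0.
rewrite /gauss_fun expRN ler_pdivrMr ?expR_gt0// mulrC ler_pdivlMr//.
by rewrite -expr2 (le_trans _ (expR_ge1Dx _))// lerDr.
Unshelve. all: end_near. Qed.

Lemma integral0y_sqr_gauss_fun (R : realType) :
  (\int[@lebesgue_measure R]_(x in `[0%R, +oo[) (2 * x ^+ 2 * gauss_fun x)%:E =
   (Num.sqrt pi / 2)%:E)%E.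
Proof.
(* [(2 x^2 - 1) exp(-x^2)] is the derivative of [- x exp(-x^2)] but changes
   sign; adding [h], which dominates [exp(-x^2)], makes it nonnegative, as
   required by [ge0_continuous_FTC2y]. *)
pose h (x : R) := expR (1 - x).
have dh (x : R) : is_derive x 1 (fun x => - h x) (h x).
  rewrite /h; apply: is_derive_eq; rewrite /GRing.scale/=; lra.
pose F (x : R) := - (x * gauss_fun x) - h x.
have dF (x : R) : is_derive x 1 F ((2 * x ^+ 2 - 1) * gauss_fun x + h x).
  by rewrite /F /gauss_fun; apply: is_derive_eq; rewrite /GRing.scale/= /h; ring.
have ch : continuous h.
  move=> x; apply: continuous_comp; last exact: continuous_expR.
  by apply: cvgB; [exact: cvg_cst|exact: cvg_id].
have h_cvg0 : h x @[x --> +oo] --> (0 : R).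
  rewrite (_ : h = fun x => expR 1 * expR (- x)); last first.
    by apply/funext => x; rewrite /h expRD.
  by rewrite -(mulr0 (expR 1)); apply: cvgM; [exact: cvg_cst|exact: cvgr_expR].
have Ih : (\int[@lebesgue_measure R]_(x in `[0%R, +oo[) (h x)%:E = (h 0)%:E)%E.
  rewrite (@ge0_continuous_FTC2y _ _ (fun x => - h x) _ 0)//.
  - by rewrite sub0e -EFinN opprK.
  - by move=> x _; exact: expR_ge0.
  - exact: continuous_subspaceT.
  - by rewrite -oppr0; apply: cvgN.
  - by apply: cvg_at_right_filter; apply: cvgN; exact: ch.
  - by move=> x _; rewrite derive1E; have [_ ->] := dh x.
have cf : continuous (fun x : R => (2 * x ^+ 2 - 1) * gauss_fun x + h x).
  move=> x; apply: cvgD; last exact: ch.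
  apply: cvgM; last exact: continuous_gauss_fun.
  apply: cvgB; last exact: cvg_cst.
  by apply: cvgM; [exact: cvg_cst|exact: exprn_continuous].
have f_ge0 (x : R) : 0 <= (2 * x ^+ 2 - 1) * gauss_fun x + h x.
  (* The exponents compare because [x ^+ 2 - x + 1] is positive for every real [x]. *)
  have gh : gauss_fun x <= h x by rewrite ler_expR; nra.
  have := gauss_fun_ge0 x; have := sqr_ge0 x; nra.
have If : (\int[@lebesgue_measure R]_(x in `[0%R, +oo[)
    ((2 * x ^+ 2 - 1) * gauss_fun x + h x)%:E = (h 0)%:E)%E.
  rewrite (@ge0_continuous_FTC2y _ _ F _ 0)//.
  - by rewrite /F mul0r oppr0 sub0r add0e -EFinN opprK.
  - exact: continuous_subspaceT.
  - rewrite -[X in _ --> X](subr0 0); apply: cvgB => //.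
    by rewrite -oppr0; apply: cvgN; exact: cvg_mul_gauss_fun.
  - apply: cvg_at_right_filter; apply: differentiable_continuous.
    by apply/derivable1_diffP; have [] := dF 0.
  - by move=> x _; rewrite derive1E; have [_ ->] := dF x.
have mg := @measurable_gauss_fun R.
have mh : measurable_fun [set: R] h by exact: continuous_measurable_fun.
have mf := continuous_measurable_fun cf.
have mq : measurable_fun [set: R] (fun x => 2 * x ^+ 2 * gauss_fun x).
  by apply: measurable_funM => //; apply: measurable_funM.
have h0 : (h 0)%:E \is a fin_num by [].
(* The finite value [h 0] is added to both sides and read once as the integral of [h], once as that
   of the derivative. Both sides are then sums of integrals of nonnegative functions, with the same
   total integrand. *)
rewrite -[LHS](addeK _ h0) -[RHS](addeK _ h0); congr (_ - _)%E.
rewrite -{1}Ih -If -integral0y_gauss -!ge0_integralD//=.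
- by apply: eq_integral => x _; rewrite -!EFinD; congr EFin; ring.
- by move=> x _; rewrite lee_fin gauss_fun_ge0.
- by apply/measurable_EFinP/measurable_funTS.
- by move=> x _; rewrite lee_fin.
- by apply/measurable_EFinP/measurable_funTS.
- by move=> x _; rewrite lee_fin mulr_ge0 ?gauss_fun_ge0// mulr_ge0 ?sqr_ge0.
- by apply/measurable_EFinP/measurable_funTS.
- by move=> x _; rewrite lee_fin expR_ge0.
- by apply/measurable_EFinP/measurable_funTS.
Qed.

Lemma integralT_sqr_gauss_fun (R : realType) :
  (\int[@lebesgue_measure R]_x (2 * x ^+ 2 * gauss_fun x)%:E =
   (Num.sqrt pi)%:E)%E.
Proof.
rewrite ge0_symfun_integralT; first last.
- by move=> x /=; rewrite /gauss_fun sqrrN.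
- move=> x; apply: cvgM; last exact: continuous_gauss_fun.
  by apply: cvgM; [exact: cvg_cst|exact: exprn_continuous].
- by move=> x; rewrite mulr_ge0 ?gauss_fun_ge0// mulr_ge0 ?sqr_ge0.
by rewrite -set_itvcy integral0y_sqr_gauss_fun -EFinM; congr EFin; rewrite mulrC divfK.
Qed.

Lemma integral_sqr_normal_pdf (R : realType) (s : R) : 0 < s ->
  (\int[@lebesgue_measure R]_x (x ^+ 2 * normal_pdf 0 s x)%:E = (s ^+ 2)%:E)%E.
Proof.
(* With [c ^+ 2 = 2 * s ^+ 2], the substitution [x / c] carries [gauss_fun] to the unnormalised
   normal density, and [c * Num.sqrt pi] is the inverse of its peak. *)
move=> s0; pose c : R := Num.sqrt (s ^+ 2 *+ 2).
have c0 : 0 < c by rewrite sqrtr_gt0 pmulrn_lgt0// exprn_gt0.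
have c2 : c ^+ 2 = s ^+ 2 *+ 2 by rewrite sqr_sqrtr// pmulrn_lge0// sqr_ge0.
have F' : (fun x : R => x / c)^`()%classic = cst c^-1.
  apply/funext => x; rewrite derive1E derive_val scaler0 add0r; exact: mulr1.
have := @integralT_sqr_gauss_fun R.
rewrite (@increasing_ge0_integration_by_substitutionT _ (fun x : R => x / c))//;
  first last.
- by move=> x; rewrite mulr_ge0 ?gauss_fun_ge0// mulr_ge0 ?sqr_ge0.
- move=> x; apply: cvgM; last exact: continuous_gauss_fun.
  by apply: cvgM; [exact: cvg_cst|exact: exprn_continuous].
- by apply/gt0_cvgMly; rewrite ?invr_gt0//; exact: cvg_id.
- by apply/gt0_cvgMlNy; rewrite ?invr_gt0//; exact: cvg_id.
- by rewrite F'; exact: is_cvg_cst.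
- by rewrite F'; exact: is_cvg_cst.
- by rewrite F' => x; exact: cvg_cst.
- by move=> x y xy; rewrite ltr_pM2r ?invr_gt0.
(* This factor sends the known value [Num.sqrt pi] to [s ^+ 2]. *)
rewrite F' => /(congr1 (fun z => (s ^+ 2 / Num.sqrt pi)%:E * z)%E).
rewrite -EFinM divfK ?gt_eqF ?sqrtr_gt0 ?pi_gt0// => <-.
rewrite -ge0_integralZl//=.
- apply: eq_integral => x _; rewrite -EFinM !fctE/=; congr EFin.
  rewrite normal_pdfE ?gt_eqF//; have -> : normal_fun 0 s x = gauss_fun (x / c).
    by rewrite /normal_fun subr0 mulNr /gauss_fun exprMn exprVn c2.
  have -> : normal_peak s = (c * Num.sqrt pi)^-1.
    by rewrite /normal_peak -mulrnAl sqrtrM// -mulr_natr mulr_ge0// sqr_ge0.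
  have -> : s ^+ 2 = c ^+ 2 / 2 by rewrite c2 -mulr_natr mulfK.
  field.
  by rewrite gt_eqF//= gt_eqF// sqrtr_gt0 pi_gt0.
- apply/measurable_EFinP/measurable_funM => //.
  apply/measurableT_comp => //; last exact: measurable_funM.
  apply: measurable_funM; last exact: measurable_gauss_fun.
  exact: measurable_funM.
- move=> x _; rewrite lee_fin !fctE/= mulr_ge0 ?invr_ge0 ?(ltW c0)//.
  by rewrite mulr_ge0 ?gauss_fun_ge0// mulr_ge0 ?sqr_ge0.
- by rewrite lee_fin divr_ge0 ?sqr_ge0 ?sqrtr_ge0.
Qed.

(** The Radon-Nikodym derivative of the normal law and the explicit density have the same integral
    over every measurable set, hence agree almost everywhere. *)
Lemma ge0_integral_normal_prob (R : realType) (m s : R) (f : R -> \bar R) :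
    measurable_fun [set: R] f -> (forall x, 0 <= f x)%E ->
  (\int[normal_prob m s]_x f x =
   \int[@lebesgue_measure R]_x (f x * (normal_pdf m s x)%:E))%E.
Proof.
move=> mf f0; have dom := @normal_prob_dominates R m s.
rewrite -(Radon_Nikodym_SigmaFinite.change_of_variables dom)//.
have mRN := measurable_int _ (Radon_Nikodym_SigmaFinite.f_integrable dom).
have mpdf := measurable_int _ (integrable_normal_pdf m s).
apply: ae_eq_integral => //; try exact: emeasurable_funM.
apply: ae_eqe_mul2l; apply: integral_ae_eq => //.
  exact: Radon_Nikodym_SigmaFinite.f_integrable.
by move=> E _ mE; rewrite -Radon_Nikodym_SigmaFinite.f_integral.
Qed.

(** Cutting the line at 0 and reflecting the negative half gives the same two half-line integrals
    for both functions, in opposite order. It serves to show that a centred normal variable has mean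
    zero. *)
Lemma ge0_integral_oppr (R : realType) (g : R -> R) :
    continuous g -> (forall x, 0 <= g x) ->
  (\int[@lebesgue_measure R]_x (g x)%:E =
   \int[@lebesgue_measure R]_x (g (- x))%:E)%E.
Proof.
move=> cg g0.
have cgN : continuous (fun x => g (- x)).
  by move=> x; apply: continuous_comp; [exact: opp_continuous|exact: cg].
have split_integral (k : R -> R) : continuous k -> (forall x, 0 <= k x) ->
    (\int[@lebesgue_measure R]_x (k x)%:E =
     \int[@lebesgue_measure R]_(x in `[0%R, +oo[) (k (- x))%:E +
     \int[@lebesgue_measure R]_(x in `[0%R, +oo[) (k x)%:E)%E.
  move=> ck k0; have mk := continuous_measurable_fun ck.
  rewrite -(setUv `]-oo, (0:R)]) setCitvl ge0_integral_setU//=; last 3 first.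
  - by apply/measurable_EFinP/measurable_funTS.
  - by move=> x _; rewrite lee_fin.
  - by rewrite -setCitvl; apply/disj_setPCl.
  rewrite integral_itv_obnd_cbnd; last exact/measurable_EFinP/measurable_funTS.
  rewrite -{1}oppr0 ge0_integration_by_substitutionNy//.
  exact: continuous_subspaceT.
rewrite split_integral// [RHS]split_integral// addeC.
by congr (_ + _)%E; apply: eq_integral => x _; rewrite opprK.
Qed.

(** * Moments of independent normal variables *)

Lemma mutually_independent2 (d : measure_display) (T : measurableType d)
    (R : realType) (P : probability T R) (I : finType) (X : I -> T -> R)
    (i j : I) (A B : set R) :
    mutually_independent P X -> i != j -> measurable A -> measurable B ->
  P (X i @^-1` A `&` X j @^-1` B) = (P (X i @^-1` A) * P (X j @^-1` B))%E.
Proof.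
move=> indep ij mA mB.
pose C k := if k == i then A else B.
have mC k : measurable (C k) by rewrite /C; case: ifP.
have := indep [set i; j]%SET C mC.
rewrite big_setU1 ?inE//= big_set1 /C eqxx eq_sym (negbTE ij) => <-.
congr (P _); apply/seteqP; split => [w [Aw Bw] k /=|w Cw].
  by rewrite !inE => /orP[]/eqP ->; rewrite ?eqxx// eq_sym (negbTE ij).
split; first by have /= := Cw i; rewrite !inE !eqxx; exact.
by have /= := Cw j; rewrite !inE !eqxx orbT eq_sym (negbTE ij); exact.
Qed.

(** The joint law agrees with the product of the marginals on rectangles, hence everywhere; Fubini
    then factors the integral of the product. *)
Lemma expectationM_indep (d : measure_display) (T : measurableType d)
    (R : realType) (P : probability T R) (X Y : {RV P >-> R}) :
    (forall A B : set R, measurable A -> measurable B ->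
      P (X @^-1` A `&` Y @^-1` B) = (P (X @^-1` A) * P (Y @^-1` B))%E) ->
    (X : T -> R) \in Lfun P 1 -> (Y : T -> R) \in Lfun P 1 ->
    ((X : T -> R) \* Y) \in Lfun P 1 ->
  'E_P[(X : T -> R) \* Y]%E = ('E_P[X] * 'E_P[Y])%E.
Proof.
move=> indep X1 Y1 XY1.
have mX : measurable_fun [set: T] X by [].
have mY : measurable_fun [set: T] Y by [].
have mXY : measurable_fun [set: T] (fun w => (X w, Y w)).
  exact/measurable_fun_pairP.
pose f (z : R * R) := (z.1 * z.2)%:E.
have mf : measurable_fun [set: R * R] f by apply/measurable_EFinP/measurable_funM.
pose XY : {RV P >-> (R * R)%type} :=
  HB.pack (fun w => (X w, Y w)) (isMeasurableFun.Build _ _ _ _ _ mXY).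
have jointE A : measurable A ->
    (distribution P X \x distribution P Y)%E A = distribution P XY A.
  by move=> mA; apply: product_measure_unique => // B C mB mC.
have integral_joint (g : R * R -> \bar R) :
    (\int[distribution P X \x distribution P Y]_z g z =
     \int[distribution P XY]_z g z)%E.
  by apply: eq_measure_integral => A mA _; exact: jointE.
have int_fXY : P.-integrable [set: T] (f \o XY) by exact/Lfun1_integrable.
have intX : P.-integrable [set: T] (EFin \o X) by exact/Lfun1_integrable.
have intY : P.-integrable [set: T] (EFin \o Y) by exact/Lfun1_integrable.
have int_id : (distribution P X).-integrable [set: R] EFin.
  exact: integrable_pushforward.
have int_idY : (distribution P Y).-integrable [set: R] EFin.
  exact: integrable_pushforward.
(* Fubini needs integrability under the product law; it is transferred from the integrability of the
   product variable under [P]. *)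
have int_f : (distribution P X \x distribution P Y)%E.-integrable setT f.
  have /integrableP[_ fin] := integrable_pushforward mXY mf int_fXY measurableT.
  by apply/integrableP; split => //; rewrite integral_joint.
have EX (Z : {RV P >-> R}) : P.-integrable [set: T] (EFin \o Z) ->
    (\int[distribution P Z]_x x%:E = 'E_P[Z])%E.
  by move=> intZ; rewrite expectation_def integral_distribution.
rewrite unlock -[LHS](integral_distribution (X := XY) mf int_fXY).
rewrite -integral_joint -integral12_prod_meas1// /fubini_F/=.
have EXE := EX X intX; have EYE := EX Y intY; rewrite unlock in EXE EYE.
have <- : (\int[distribution P X]_x (x%:E * \int[P]_w (Y w)%:E) =
           \int[P]_w (X w)%:E * \int[P]_w (Y w)%:E)%E.
  have /fineK <- : (\int[P]_w (Y w)%:E)%E \is a fin_num by exact: integrable_fin_num.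
  by rewrite integralZr// EXE.
by apply: eq_integral => x _; rewrite -EYE -integralZl.
Qed.

(** * Moments of a single centred normal variable *)

Section NormalMoments.
Context (d : measure_display) (T : measurableType d) (R : realType).
Variables (P : probability T R) (X : {RV P >-> R}) (s : R).
Hypothesis s0 : 0 < s.
Hypothesis lawX : forall A : set R, measurable A ->
  distribution P X A = normal_prob 0 s A.

Lemma ge0_integral_normal_rv (f : R -> R) :
    measurable_fun [set: R] f -> (forall x, 0 <= f x) ->
  (\int[P]_w (f (X w))%:E =
   \int[@lebesgue_measure R]_x (f x * normal_pdf 0 s x)%:E)%E.
Proof.
move=> mf f0.
(* [R] and [measurableTypeR R] have the same measurable sets, but distinct
   displays; [normal_prob] lives on the latter. *)
have mX : measurable_fun [set: T] (X : T -> measurableTypeR R).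
  exact: (measurable_funPT X).
pose X' : {RV P >-> measurableTypeR R} :=
  HB.pack (X : T -> measurableTypeR R) (isMeasurableFun.Build _ _ _ _ _ mX).
have mfE : measurable_fun [set: measurableTypeR R] (EFin \o f).
  exact/measurable_EFinP.
rewrite -[LHS](@ge0_integral_distribution _ _ _ _ _ _ X' (EFin \o f))//.
under [RHS]eq_integral do rewrite EFinM.
rewrite -(@ge0_integral_normal_prob _ _ _ (EFin \o f))//.
by apply: eq_measure_integral => A mA _; exact: lawX.
Qed.

Lemma normal_rv_sqr : (\int[P]_w (X w ^+ 2)%:E = (s ^+ 2)%:E)%E.
Proof.
rewrite (ge0_integral_normal_rv (f := fun x => x ^+ 2)).
- exact: integral_sqr_normal_pdf.
- exact: measurable_funX.
- by move=> x; exact: sqr_ge0.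
Qed.

Lemma normal_rv_Lfun2 : (X : T -> R) \in Lfun P 2%:E.
Proof.
rewrite inE; apply/andP; split; rewrite inE//= /finite_norm unlock/=.
rewrite poweR_lty//.
under eq_integral => w _.
  rewrite powR_mulrn ?normr_ge0// real_normK ?num_real//.
  over.
by rewrite normal_rv_sqr ltry.
Qed.

Lemma normal_rv_Lfun1 : (X : T -> R) \in Lfun P 1.
Proof.
by apply: Lfun_subset12 normal_rv_Lfun2; rewrite fin_num_measure.
Qed.

(** The density is even, so the positive and negative parts have equal integrals; integrability
    makes these finite, so their difference is genuinely zero. *)
Lemma normal_rv_mean : (\int[P]_w (X w)%:E = 0)%E.
Proof.
have intX : P.-integrable [set: T] (EFin \o X).
  by exact/Lfun1_integrable/normal_rv_Lfun1.
have /integrable_fin_num := integrable_funepos measurableT intX.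
move=> /(_ measurableT) fin.
rewrite integralE; suff <- :
  (\int[P]_w ((EFin \o X)^\+ w) = \int[P]_w ((EFin \o X)^\- w))%E by rewrite subee.
have posE w : ((EFin \o X)^\+ w = (Num.max (X w) 0)%:E)%E by rewrite funeposE EFin_max.
have negE w : ((EFin \o X)^\- w = (Num.max (- X w) 0)%:E)%E by rewrite funenegE EFin_max.
under eq_integral do rewrite posE; under [RHS]eq_integral do rewrite negE.
have mmax (g : R -> R) : measurable_fun setT g ->
    measurable_fun setT (fun x => Num.max (g x) 0).
  by move=> mg; exact: measurable_maxr.
rewrite (ge0_integral_normal_rv (f := fun x => Num.max x 0)); first last.
- by move=> x; rewrite le_max lexx orbT.
- exact: mmax.
rewrite (ge0_integral_normal_rv (f := fun x => Num.max (- x) 0)); first last.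
- by move=> x; rewrite le_max lexx orbT.
- exact: mmax.
have cmax : continuous (fun x : R => Num.max x 0).
  rewrite (_ : (fun x => _) = fun x : R => (x + `|x|) / 2).
    move=> x; apply: cvgM; last exact: cvg_cst.
    by apply: cvgD; [exact: cvg_id|exact: norm_continuous].
  by apply/funext => x; rewrite maxr_absE addr0 subr0.
rewrite ge0_integral_oppr; first last.
- by move=> x; rewrite mulr_ge0 ?normal_pdf_ge0// le_max lexx orbT.
- move=> x; apply: cvgM; last by apply: continuous_normal_pdf; rewrite gt_eqF.
  exact: cmax.
apply: eq_integral => x _; rewrite !normal_pdfE ?gt_eqF// /normal_fun.
by rewrite !subr0 sqrrN.
Qed.

End NormalMoments.

(** * Expectations of affine combinations and of their squares *)

Section LinearCombinations.
Context (d : measure_display) (T : measurableType d) (R : realType).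
Variable P : probability T R.

Lemma EFin_lincomb (I : finType) (a c : I -> R) :
  (\sum_i c i * a i)%:E = (\sum_i (c i)%:E * (a i)%:E)%E.
Proof. by rewrite -sumEFin; apply: eq_bigr => i _; rewrite EFinM. Qed.

Lemma Lfun1_lincomb (I : finType) (f : I -> T -> R) (c : I -> R) :
    (forall i, f i \in Lfun P 1) ->
  (fun w => \sum_i c i * f i w) \in Lfun P 1.
Proof.
move=> fP; apply/Lfun1_integrable.
rewrite (_ : EFin \o _ = fun w => (\sum_i (c i)%:E * (f i w)%:E)%E).
  apply: integrable_sum => // i _; apply: integrableZl => //.
  exact/Lfun1_integrable.
by apply/funext => w; exact: EFin_lincomb.
Qed.

Lemma expectation_lincomb (I : finType) (f : I -> T -> R) (m c : I -> R) :
    (forall i, f i \in Lfun P 1) -> (forall i, 'E_P[f i]%E = (m i)%:E) ->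
  'E_P[(fun w => \sum_i c i * f i w)%R]%E = (\sum_i c i * m i)%:E.
Proof.
move=> fP fm; rewrite unlock.
have fint i : P.-integrable setT (EFin \o f i) by exact/Lfun1_integrable.
under eq_integral do rewrite EFin_lincomb.
rewrite integral_sum//=; last by move=> i; apply: integrableZl => //; exact: fint.
rewrite -sumEFin; apply: eq_bigr => i _.
by rewrite (integralZl measurableT (fint i)) EFinM -fm unlock.
Qed.

Lemma expectation_affine (I : finType) (X : I -> T -> R) (c : I -> R) (b : R) :
    (forall i, X i \in Lfun P 1) -> (forall i, 'E_P[X i]%E = 0%E) ->
  'E_P[(fun w => b + \sum_i c i * X i w)%R]%E = b%:E.
Proof.
move=> XP X0.
rewrite (expectationD (Lfun_cst P b 1) (Lfun1_lincomb c XP)).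
rewrite expectation_cst (expectation_lincomb (m := fun=> 0))//.
by rewrite big1 ?adde0// => i _; rewrite mulr0.
Qed.

(** The square expands into an affine part and a double sum over pairs. The factor [v *+ (i == j)]
    is [v] times the Kronecker delta, so only the diagonal of the double sum survives. *)
Lemma expectation_sqr_affine (I : finType) (X : I -> T -> R) (c : I -> R)
    (b v : R) :
    (forall i, X i \in Lfun P 2%:E) -> (forall i, 'E_P[X i]%E = 0%E) ->
    (forall i j, 'E_P[X i \* X j]%E = (v *+ (i == j))%:E) ->
  'E_P[(fun w => (b + \sum_i c i * X i w) ^+ 2)%R]%E =
  (b ^+ 2 + v * \sum_i c i ^+ 2)%:E.
Proof.
move=> X2 X0 XX.
have X1 i : X i \in Lfun P 1 by apply: Lfun_subset12 (X2 i); rewrite fin_num_measure.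
pose XX2 (ij : I * I) := X ij.1 \* X ij.2.
pose cc (ij : I * I) := c ij.1 * c ij.2.
have XX1 ij : XX2 ij \in Lfun P 1 by exact: Lfun2_mul_Lfun1.
pose Z w := b ^+ 2 + \sum_i (2 * b * c i) * X i w.
have ZE : Z = cst (b ^+ 2) \+ (fun w => \sum_i (2 * b * c i) * X i w) by [].
have Z1 : Z \in Lfun P 1.
  by rewrite ZE; apply: rpredD; [exact: Lfun_cst|exact: Lfun1_lincomb].
have -> : (fun w => (b + \sum_i c i * X i w) ^+ 2) =
    Z \+ (fun w => \sum_ij cc ij * XX2 ij w).
  apply/funext => w; rewrite sqrrD /Z/=; congr (_ + _ + _).
    rewrite -mulrnAl -mulr_natl mulr_sumr; apply: eq_bigr => i _; ring.
  rewrite expr2 big_distrlr/= pair_big/=; apply: eq_bigr => -[i j] _ /=.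
  rewrite /cc /XX2 /=; ring.
rewrite (expectationD Z1 (Lfun1_lincomb cc XX1)) expectation_affine//.
rewrite (expectation_lincomb (m := fun ij => v *+ (ij.1 == ij.2))); first last.
- by move=> -[i j]; exact: XX.
- exact: XX1.
rewrite -EFinD; congr (_ + _)%:E.
rewrite -(pair_big xpredT xpredT (fun i j => cc (i, j) * (v *+ (i == j))))/=.
rewrite mulr_sumr; apply: eq_bigr => i _.
rewrite (bigD1 i)//= eqxx big1 ?addr0 ?mulr1n; first by rewrite /cc/=; ring.
by move=> j; rewrite eq_sym => /negbTE ->; rewrite mulr0.
Qed.

Lemma iid_normal_moments (I : finType) (s : R) (X : I -> {RV P >-> R}) :
    0 < s -> iid_normal 0 s X ->
  [/\ forall i, (X i : T -> R) \in Lfun P 2%:E,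
      forall i, 'E_P[X i]%E = 0%E &
      forall i j, 'E_P[(X i : T -> R) \* X j]%E = (s ^+ 2 *+ (i == j))%:E].
Proof.
move=> s0 [indep law].
have X2 i : (X i : T -> R) \in Lfun P 2%:E by exact: normal_rv_Lfun2 s0 (law i).
have X0 i : 'E_P[X i]%E = 0%E by rewrite unlock; exact: normal_rv_mean s0 (law i).
split=> // i j; have [<-|ij] := eqVneq i j.
  by rewrite mulr1n unlock -(normal_rv_sqr s0 (law i)).
rewrite expectationM_indep ?X0 ?mul0e//.
- by move=> A B mA mB; exact: mutually_independent2 indep ij mA mB.
- exact: normal_rv_Lfun1 s0 (law i).
- exact: normal_rv_Lfun1 s0 (law j).
- exact: Lfun2_mul_Lfun1.
Qed.

End LinearCombinations.

(** * Least squares in the submodel *)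

Section LeastSquares.
Variables (R : realType) (n p : nat) (x : 'I_n -> 'cV[R]_p).

Lemma mul_Sigma (v : 'cV[R]_p) :
  Sigma x *m v = n%:R^-1 *: \sum_i dotv (x i) v *: x i.
Proof.
rewrite /Sigma -scalemxAl mulmx_suml; congr (_ *: _); apply: eq_bigr => i _.
by rewrite -mulmxA [(x i)^T *m v]mx11_scalar mul_mx_scalar.
Qed.

(** For [u = v] the right side is a mean of squares; this gives both definiteness of the submodel
    matrix and the sum of squared coefficients of the estimator. *)
Lemma dotv_Sigma (u v : 'cV[R]_p) :
  dotv u (Sigma x *m v) = n%:R^-1 * \sum_i dotv u (x i) * dotv (x i) v.
Proof.
rewrite mul_Sigma dotvZr dotv_sumr; congr (_ * _); apply: eq_bigr => i _.
by rewrite dotvZr mulrC.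
Qed.

Lemma trmx_Sigma : (Sigma x)^T = Sigma x.
Proof.
rewrite /Sigma linearZ/= linear_sum/=; congr (_ *: _); apply: eq_bigr => i _.
by rewrite trmx_mul trmxK.
Qed.

End LeastSquares.

(** * Coefficients and noiseless value of the submodel estimator *)

Section Submodel.
Variables (R : realType) (n p : nat) (x : 'I_n -> 'cV[R]_p) (S : {set 'I_p}).
Hypothesis n0 : (0 < n)%N.
Hypothesis Sigma_unit : Sigma x \in unitmx.

Lemma Sigma00_unitmx : Sigma00 x S \in unitmx.
Proof.
rewrite -SigmaSE -row_free_unit -kermx_eq0; apply/rowV0P => u /sub_kermxP uS.
(* [v^T SigmaS v] is [1/n] times a sum of squares. *)
pose v := u^T; pose v' := (selmx R S)^T *m v.
have vS : SigmaS x S *m v = 0.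
  by rewrite /SigmaS -trmx_Sigma /v -trmx_mul uS trmx0.
have : dotv v (SigmaS x S *m v) = 0 by rewrite vS /dotv mulmx0 mxE.
rewrite /SigmaS dotv_Sigma => /eqP.
rewrite mulf_eq0 invr_eq0 pnatr_eq0 -leqn0 leqNgt n0/=.
rewrite psumr_eq0; last by move=> i _; rewrite dotvC -expr2 sqr_ge0.
move=> /allP x0.
(* [v'] is [v] padded with zeros outside [S]. Every [x i] is orthogonal to it, so [Sigma x]
   annihilates it, and invertibility forces it to vanish. *)
have v'0 : v' = 0.
  rewrite -[v'](mulKmx Sigma_unit) mul_Sigma big1 ?scaler0 ?mulmx0// => i _.
  have /x0/= : i \in index_enum 'I_n by rewrite mem_index_enum.
  rewrite (dotvC (subv S _)) -expr2 sqrf_eq0 dotv_subv dotvC => /eqP ->.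
  by rewrite scale0r.
have v0 : v = 0 by rewrite -[v]mul1mx -(selmx_orthonormal R S) -mulmxA -/v' v'0 mulmx0.
by rewrite -[u]trmxK -/v v0 trmx0.
Qed.

Variables (x0 : 'cV[R]_p).
Local Notation g := (invmx (SigmaS x S) *m subv S x0).

Lemma trmx_invmx_SigmaS : (invmx (SigmaS x S))^T = invmx (SigmaS x S).
Proof. by rewrite trmx_inv /SigmaS trmx_Sigma. Qed.

Lemma muhat_lincomb (y : 'I_n -> R) :
  muhat x y x0 S = \sum_i (n%:R^-1 * dotv g (subv S (x i))) * y i.
Proof.
rewrite /muhat /betahat dotv_mulmx trmx_invmx_SigmaS dotvZr dotv_sumr mulr_sumr.
by apply: eq_bigr => i _; rewrite dotvZr mulrCA mulrC.
Qed.

Lemma sum_sqr_muhat_coef :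
  \sum_i (n%:R^-1 * dotv g (subv S (x i))) ^+ 2 =
  n%:R^-1 * dotv (subv S x0) g.
Proof.
have SigmaS_unit : SigmaS x S \in unitmx by rewrite SigmaSE Sigma00_unitmx.
have -> : dotv (subv S x0) g = dotv g (SigmaS x S *m g) by rewrite mulKVmx// dotvC.
rewrite /SigmaS dotv_Sigma !mulr_sumr; apply: eq_bigr => i _.
by rewrite (dotvC (subv S (x i))); ring.
Qed.

Lemma muhat_noiseless (beta : 'cV[R]_p) :
  muhat x (fun i => dotv (x i) beta) x0 S =
  dotv x0 beta + dotv (omega x x0 S) (subv (~: S)%SET beta).
Proof.
have SigmaS_unit : SigmaS x S \in unitmx by rewrite SigmaSE Sigma00_unitmx.
(* On noiseless data the averaged cross products form the [S]-block of [Sigma x *m beta]. In the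
   block expansion that follows, the [S]-part of [beta] meets [subv S x0], and the rest produces the
   first term of [omega]. *)
have -> : muhat x (fun i => dotv (x i) beta) x0 S =
          dotv g (subv S (Sigma x *m beta)).
  rewrite muhat_lincomb dotv_subv dotv_Sigma mulr_sumr; apply: eq_bigr => i _.
  by rewrite dotv_subv mulrA.
rewrite (subv_mul S) -/(Sigma00 x S) -/(Sigma01 x S).
rewrite dotvC dotvDl !(dotvC _ g) !dotv_mulmx.
rewrite /Sigma00 trmx_submx_of ?trmx_Sigma// -/(Sigma00 x S) -SigmaSE mulKVmx//.
rewrite (dotv_split S x0) /omega dotvBl -SigmaSE mulmxA.
by rewrite -[RHS]addrA [X in _ = _ + X]addrC subrK.
Qed.

End Submodel.

(** * Bias, decomposition of the quadratic form, and mean squared error *)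

Theorem lemma1 (R : realType) (d : measure_display) (T : measurableType d)
    (P : probability T R) (n p : nat) (hp : (1 <= p)%N) (hnp : (p <= n)%N)
    (x : 'I_n -> 'cV[R]_p) (hrank : \rank (Sigma x) = p)
    (beta : 'cV[R]_p) (sigma : R) (hsigma : 0 < sigma)
    (eps : 'I_n -> {RV P >-> R}) (heps : iid_normal 0 sigma eps)
    (y : 'I_n -> T -> R)
    (hy : forall i w, y i w = dotv (x i) beta + eps i w)
    (x0 : 'cV[R]_p) (S : {set 'I_p}) :
  let mu := dotv x0 beta in
  let muhatS := fun w : T => muhat x (fun i => y i w) x0 S in
  let mseS := 'E_P[(fun w => (muhatS w - mu) ^+ 2)%R]%E in
  let omegaS := omega x x0 S in
  let bS := dotv omegaS (subv (~: S)%SET beta) in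
  let vS := dotv (subv S x0) (invmx (SigmaS x S) *m subv S x0) in
  let v := dotv x0 (invmx (Sigma x) *m x0) in
  let qS := dotv omegaS (Q x S *m omegaS) in
  [/\ ('E_P[muhatS] - mu%:E)%E = bS%:E,
      v = vS + qS
    & [/\ mseS = (sigma ^+ 2 / n%:R * vS + bS ^+ 2)%:E,
          mseS = (sigma ^+ 2 / n%:R *
                    (vS + n%:R * bS ^+ 2 / sigma ^+ 2))%:E
        & mseS = (sigma ^+ 2 / n%:R *
                    (v + n%:R * bS ^+ 2 / sigma ^+ 2 - qS))%:E]].
Proof.
move=> mu muhatS mseS omegaS bS vS v qS.
have n0 : (0 < n)%N by exact: leq_trans hp hnp.
have Sigma_unit : Sigma x \in unitmx by rewrite -row_free_unit -row_leq_rank hrank.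
have [eps2 eps0 epsM] := iid_normal_moments hsigma heps.
have eps1 i : (eps i : T -> R) \in Lfun P 1.
  by apply: Lfun_subset12 (eps2 i); rewrite fin_num_measure.
pose g := invmx (SigmaS x S) *m subv S x0.
pose c i := n%:R^-1 * dotv g (subv S (x i)).
have muhatE w : muhatS w = mu + bS + \sum_i c i * eps i w.
  (* Linearity in the data separates the noiseless value, which carries the bias, from the
     combination of errors. *)
  rewrite -(muhat_noiseless S n0 Sigma_unit) /muhatS !muhat_lincomb -big_split/=.
  by apply: eq_bigr => i _; rewrite hy mulrDr.
have vE : v = vS + qS.
  rewrite /v (quad_inv_block (S := S)) ?trmx_Sigma//; last exact: Sigma00_unitmx.
  by rewrite /vS SigmaSE.
have n_neq0 : n%:R != 0 :> R by rewrite pnatr_eq0 -lt0n.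
have mseE : mseS = (sigma ^+ 2 / n%:R * vS + bS ^+ 2)%:E.
  rewrite /mseS (_ : (fun w => _) = fun w => (bS + \sum_i c i * eps i w) ^+ 2).
    rewrite (expectation_sqr_affine _ _ eps2 eps0 epsM) sum_sqr_muhat_coef//.
    by rewrite addrC mulrA.
  by apply/funext => w; rewrite muhatE addrAC [mu + bS]addrC addrK.
split=> //.
  rewrite (_ : muhatS = fun w => (mu + bS) + \sum_i c i * eps i w); last exact/funext.
  by rewrite expectation_affine// -EFinB addrAC subrr add0r.
have sigma_neq0 : sigma != 0 by rewrite gt_eqF.
(* The second form factors out [sigma ^+ 2 / n%:R]; the third replaces [vS] by [v - qS]. *)
split=> //; rewrite mseE; congr EFin; first by field; rewrite sigma_neq0.
by rewrite vE; field; rewrite sigma_neq0.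
Qed.
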